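(* Let $A\colon\mathcal{X}\to 2^{\mathcal{X}^*}$, let $x\in\mathcal{X}$, let $u^*\in\mathcal{X}^*$, and let $\gamma\in\,]0,+\infty[$. Suppose that $z\in R_{\gamma(A-u^* )}x$. Then $$H_A(x,u^* )\geq\frac{\|x-z\|^2}{\gamma}\geq\frac{1}{2}d^2_{\operatorname{gra}A,\gamma}(x,u^* ).$$
   Context: $\mathcal{X}\neq\{0\}$ is a reflexive real Banach space with topological dual $\mathcal{X}^*$, and $\langle\cdot,\cdot\rangle$ is the canonical duality pairing. For a set-valued operator $A\colon\mathcal{X}\to 2^{\mathcal{X}^*}$, $\operatorname{gra}A=\{(x,x^* )\in\mathcal{X}\times\mathcal{X}^*\mid x^*\in Ax\}$. The Haraux function of $A$ is $H_A\colon\mathcal{X}\times\mathcal{X}^*\to[-\infty,+\infty]\colon(x,u^* )\mapsto\sup_{(y,y^* )\in\operatorname{gra}A}\langle x-y,y^*-u^*\rangle$. The duality mapping of $\mathcal{X}$ is $\Delta\colon\mathcal{X}\to2^{\mathcal{X}^*}\colon x\mapsto\{x^*\in\mathcal{X}^*\mid\|x\|^2=\langle x,x^*\rangle=\|x^*\|^2\}$. The metric resolvent of an operator $A\colon\mathcal{X}\to 2^{\mathcal{X}^*}$ is $R_A\colon\mathcal{X}\to2^{\mathcal{X}}\colon x\mapsto\{z\in\mathcal{X}\mid 0\in Az+\Delta(z-x)\}$. For $u^*\in\mathcal{X}^*$ and $\gamma>0$, $\gamma(A-u^* )$ is the operator $x\mapsto\{\gamma(x^*-u^* )\mid x^*\in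 Ax\}$. For $\gamma\in\,]0,+\infty[$, set $|||(x,x^* )|||_\gamma=\sqrt{\|x\|^2/\gamma+\gamma\|x^*\|^2}$ for $(x,x^* )\in\mathcal{X}\times\mathcal{X}^*$, and for $\boldsymbol{C}\subset\mathcal{X}\times\mathcal{X}^*$ set $d_{\boldsymbol{C},\gamma}(x,x^* )=\inf_{(y,y^* )\in\boldsymbol{C}}|||(x,x^* )-(y,y^* )|||_\gamma\in[0,+\infty]$. *)

(* Defs.v *)
From HB Require Import structures.
From mathcomp Require Import all_boot all_order all_algebra.
From mathcomp Require Import all_classical all_reals all_analysis.

Set Implicit Arguments.
Unset Strict Implicit.
Unset Printing Implicit Defensive.

Import Order.TTheory GRing.Theory Num.Theory.
Import numFieldNormedType.Exports.

Local Open Scope classical_set_scope.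
Local Open Scope ring_scope.

Section dual_space.
Context {R : realType} (X : normedModType R).

Definition dual_pred : {pred X -> R^o} :=
  mem [set f : X -> R^o | linear f /\ continuous f].

Record dual := Dual {
  dual_fun :> X -> R^o ;
  dual_funP : dual_fun \in dual_pred }.

HB.instance Definition _ := [isSub for dual_fun].
HB.instance Definition _ := [Choice of dual by <:].

Lemma dual_submod_closed : submod_closed dual_pred.
Proof.
split.
  rewrite inE; split => [a x y|x]; last exact: cst_continuous.
  by rewrite scaler0 addr0.
move=> a f g /[!inE] -[lf cf] [lg cg]; split.
  move=> b x y /=.
  rewrite !fctE lf lg !scalerDr !scalerA (mulrC a b).
  by rewrite -!addrA; congr (_ + _); rewrite addrCA.
move=> x; apply: (@continuousD _ _ _ (a *: f) g); last exact: cg.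
by apply: continuousZl_tmp; exact: cf.
Qed.

HB.instance Definition _ :=
  GRing.isSubmodClosed.Build _ _ dual_pred dual_submod_closed.
HB.instance Definition _ := [SubChoice_isSubLmodule of dual by <:].

Lemma dual_linear (f : dual) : linear f.
Proof. by have := dual_funP f; rewrite inE => -[]. Qed.

HB.instance Definition _ (f : dual) :=
  GRing.isLinear.Build R X R^o _ (dual_fun f) (@dual_linear f).

Lemma dual_continuous (f : dual) : continuous f.
Proof. by have := dual_funP f; rewrite inE => -[]. Qed.

Lemma dualD (f g : dual) x : (f + g) x = f x + g x.
Proof. by []. Qed.

Lemma dualZ (a : R) (f : dual) x : (a *: f) x = a * f x.
Proof. by []. Qed.

Lemma dual_eqP (f g : dual) : f =1 g -> f = g.
Proof. by move=> fg; apply/val_inj/funext. Qed.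

Definition dual_norm (f : dual) : R :=
  sup [set `|f x| | x in [set x | `|x| <= 1]].

Lemma dual_has_sup (f : dual) : has_sup [set `|f x| | x in [set x | `|x| <= 1]].
Proof.
split; first by exists `|f 0|, 0 => //=; rewrite normr0.
have /linear_bounded_continuous/linear_boundedP/pinfty_ex_gt0[M M0 fM] :=
  @dual_continuous f.
exists M => _ [x /= x1 <-].
by rewrite (le_trans (fM x))// ler_piMr// ltW.
Qed.

Lemma dual_norm_ubound (f : dual) x : `|f x| <= dual_norm f * `|x|.
Proof.
have [->|x0] := eqVneq x 0; first by rewrite linear0 !normr0 mulr0.
have nx0 : 0 < `|x| by rewrite normr_gt0.
rewrite -ler_pdivrMr// mulrC -[X in X * _]ger0_norm ?invr_ge0//.
rewrite -normrM -[X in `|X|]/(`|x|^-1 *: f x) -linearZ.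
apply: (sup_upper_bound (dual_has_sup f)).
exists (`|x|^-1 *: x) => //=.
by rewrite normrZ ger0_norm ?invr_ge0// mulVf// gt_eqF.
Qed.

Lemma dual_norm_le (f : dual) (M : R) :
  (forall x, `|x| <= 1 -> `|f x| <= M) -> dual_norm f <= M.
Proof.
move=> fM; apply: ge_sup; first by case: (dual_has_sup f).
by move=> _ [x /= x1 <-]; exact: fM.
Qed.

Lemma dual_norm_ge0 (f : dual) : 0 <= dual_norm f.
Proof.
apply: (sup_upper_bound (dual_has_sup f)).
by exists 0; rewrite /= ?linear0 normr0.
Qed.

Lemma ler_dual_normD (f g : dual) :
  dual_norm (f + g) <= dual_norm f + dual_norm g.
Proof.
apply: dual_norm_le => x x1; rewrite dualD (le_trans (ler_normD _ _))//.
by apply: lerD; rewrite (le_trans (dual_norm_ubound _ x))//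
  ler_piMr// dual_norm_ge0.
Qed.

Let dual_normZ_le (a : R) (f : dual) :
  dual_norm (a *: f) <= `|a| * dual_norm f.
Proof.
apply: dual_norm_le => x x1; rewrite dualZ normrM ler_wpM2l//.
by rewrite (le_trans (dual_norm_ubound f x))// ler_piMr// dual_norm_ge0.
Qed.

Lemma dual_normZ (a : R) (f : dual) : dual_norm (a *: f) = `|a| * dual_norm f.
Proof.
apply/eqP; rewrite eq_le dual_normZ_le/=.
have [->|a0] := eqVneq a 0; first by rewrite normr0 mul0r dual_norm_ge0.
rewrite -ler_pdivlMl ?normr_gt0// -normfV.
by rewrite -[in leLHS](scale1r f) -(mulVf a0) -scalerA dual_normZ_le.
Qed.

Lemma dual_norm0_eq0 (f : dual) : dual_norm f = 0 -> f = 0.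
Proof.
move=> f0; apply: dual_eqP => x; apply/eqP; rewrite -normr_le0.
by rewrite (le_trans (dual_norm_ubound f x))// f0 mul0r.
Qed.

HB.instance Definition _ :=
  Lmodule_isNormed.Build R dual ler_dual_normD dual_normZ dual_norm0_eq0.

Lemma dual_normE (f : dual) :
  `|f| = sup [set `|f x| | x in [set x | `|x| <= 1]].
Proof. by []. Qed.

Lemma ler_dual_norm (f : dual) x : `|f x| <= `|f| * `|x|.
Proof. exact: dual_norm_ubound. Qed.

End dual_space.

Arguments dual_pred {R} X.

Definition pairing {R : realType} {X : normedModType R} (x : X) (f : dual X) : R :=
  f x.

Section reflexive.
Context {R : realType} (X : normedModType R).

Lemma dual_eval_subproof (x : X) :
  (fun f : dual X => pairing x f : R^o) \in dual_pred (dual X).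
Proof.
have lx : linear (fun f : dual X => pairing x f : R^o).
  by move=> a f g; rewrite /pairing dualD dualZ.
rewrite inE; split=> //.
pose ev : {linear dual X -> R^o} :=
  HB.pack (fun f : dual X => pairing x f : R^o)
    (GRing.isLinear.Build _ _ _ _ _ lx).
apply: (@bounded_linear_continuous _ _ _ ev); apply/linear_boundedP.
near=> r => f; rewrite (le_trans (ler_dual_norm f x))// mulrC ler_wpM2r//.
Unshelve. all: by end_near. Qed.

Definition dual_eval (x : X) : dual (dual X) := Dual (dual_eval_subproof x).

Definition reflexive_space : Prop := set_surj setT setT dual_eval.

End reflexive.

Section operators.
Context {R : realType} {X : normedModType R}.
Implicit Types (A : X -> set (dual X)) (x : X) (u : dual X) (gamma : R).

Definition gra A : set (X * dual X) := [set p | A p.1 p.2].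

Definition haraux A x u : \bar R :=
  ereal_sup [set (pairing (x - p.1) (p.2 - u))%:E | p in gra A].

Definition duality_mapping x : set (dual X) :=
  [set f | `|x| ^+ 2 = pairing x f /\ pairing x f = `|f| ^+ 2].

Definition metric_resolvent A x : set X :=
  [set z | [set a + b | a in A z & b in duality_mapping (z - x)] 0].

Definition shift_scale gamma A u : X -> set (dual X) :=
  fun x => [set gamma *: (a - u) | a in A x].

Definition gamma_norm gamma (p : X * dual X) : R :=
  Num.sqrt (`|p.1| ^+ 2 / gamma + gamma * `|p.2| ^+ 2).

(* The infimum is taken in \bar R, so that it is +oo when C is empty. *)
Definition gamma_dist (C : set (X * dual X)) gamma (p : X * dual X) : \bar R :=
  ereal_inf [set (gamma_norm gamma (p - q))%:E | q in C].

End operators.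

(* Main.v *)
Require Import Defs.
From mathcomp Require Import all_boot all_order all_algebra.
From mathcomp Require Import all_classical all_reals all_analysis.

(** Membership of [z] in the metric resolvent produces one point [(z, y)] of the
    graph of [A] such that [gamma *: (u - y)] lies in the duality mapping at
    [z - x].  The two equations of the duality mapping then say that the two
    coordinates of [(x, u) - (z, y)] contribute equally to the [gamma]-norm,
    and that the pairing of [x - z] with [y - u] takes the same common value
    [`|x - z| ^+ 2 / gamma].  Both inequalities follow by testing the supremum
    that defines the Haraux function, and the infimum that defines the
    distance, at the single point [(z, y)]: in the first the tested value is
    exactly [`|x - z| ^+ 2 / gamma], in the second its square is exactly twice
    that, whence the factor [1/2]. *)

Set Implicit Arguments.
Unset Strict Implicit.
Unset Printing Implicit Defensive.

Import Order.TTheory GRing.Theory Num.Theory.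
Import numFieldNormedType.Exports.

Local Open Scope classical_set_scope.
Local Open Scope ring_scope.

Lemma haraux_ge (R : realType) (X : normedModType R) (A : X -> set (dual X))
    (x z : X) (u y : dual X) :
  A z y -> ((pairing (x - z) (y - u))%:E <= haraux A x u)%E.
Proof. by move=> Azy; apply: ereal_sup_ubound; exists (z, y). Qed.

(** Squaring preserves the order here because both sides of
    [gamma_dist C gamma p <= gamma_norm gamma (p - q)] are nonnegative. *)
Lemma gamma_dist_sqr_le (R : realType) (X : normedModType R)
    (C : set (X * dual X)) (gamma : R) (p q : X * dual X) :
  0 <= gamma -> C q ->
  (gamma_dist C gamma p ^+ 2
     <= (`|(p - q).1| ^+ 2 / gamma + gamma * `|(p - q).2| ^+ 2)%:E)%E.
Proof.
move=> gamma_ge0 Cq.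
have d_ge0 : (0 <= gamma_dist C gamma p)%E.
  by apply: le_ereal_inf_tmp => _ [r _ <-]; rewrite lee_fin sqrtr_ge0.
have d_le : (gamma_dist C gamma p <= (gamma_norm gamma (p - q))%:E)%E.
  by apply: ge_ereal_inf; exists (gamma_norm gamma (p - q))%:E => //; exists q.
have -> : `|(p - q).1| ^+ 2 / gamma + gamma * `|(p - q).2| ^+ 2
    = gamma_norm gamma (p - q) ^+ 2.
  by rewrite sqr_sqrtr// addr_ge0// ?divr_ge0 ?mulr_ge0 ?sqr_ge0.
by rewrite EFin_expe lee_sqr// lee_fin sqrtr_ge0.
Qed.

(** The witness [y] is where the resolvent inclusion is attained: the element of
    the duality mapping at [z - x] is [gamma *: (u - y)], so its norm equation
    rescales to the last equality and its pairing equation to the other one. *)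
Lemma metric_resolvent_shift_scale (R : realType) (X : normedModType R)
    (A : X -> set (dual X)) (x z : X) (u : dual X) (gamma : R) :
  0 < gamma -> metric_resolvent (shift_scale gamma A u) x z ->
  exists y, [/\ A z y,
    pairing (x - z) (y - u) = `|x - z| ^+ 2 / gamma &
    gamma * `|u - y| ^+ 2 = `|x - z| ^+ 2 / gamma].
Proof.
move=> gamma_gt0 [_ [y Azy <-]] [b [norm_pair pair_norm]] ab0.
have gamma_neq0 : gamma != 0 by rewrite gt_eqF.
have bE : b = gamma *: (u - y).
  by apply/eqP; rewrite -[u - y]opprB scalerN -addr_eq0 addrC ab0.
exists y; split=> //.
  rewrite (distrC x) norm_pair bE.
  have -> : pairing (z - x) (gamma *: (u - y))
      = gamma * pairing (x - z) (y - u).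
    by rewrite /pairing dualZ -(opprB x z) linearN -(opprB y u) /= opprK.
  by rewrite mulrAC divff// mul1r.
rewrite (distrC x) norm_pair pair_norm bE normrZ gtr0_norm// exprMn expr2.
by rewrite mulrAC mulfK.
Qed.

Theorem proposition3p5 (R : realType) (X : completeNormedModType R)
    (X_neq0 : exists v : X, v != 0) (X_reflexive : reflexive_space X)
    (A : X -> set (dual X)) (x : X) (u : dual X) (gamma : R)
    (gamma_gt0 : 0 < gamma) (z : X)
    (hz : metric_resolvent (shift_scale gamma A u) x z) :
  (haraux A x u >= (`|x - z| ^+ 2 / gamma)%:E)%E /\
  ((`|x - z| ^+ 2 / gamma)%:E
     >= (2^-1)%:E * gamma_dist (gra A) gamma (x, u) ^+ 2)%E.
Proof.
have [y [Azy pairE normE]] := metric_resolvent_shift_scale gamma_gt0 hz.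
split; first by rewrite -pairE; exact: haraux_ge.
have := @gamma_dist_sqr_le _ _ (gra A) _ (x, u) (z, y) (ltW gamma_gt0) Azy.
rewrite /= normE => d_le.
have half_ge0 : (0 <= (2^-1 : R)%:E)%E by rewrite lee_fin invr_ge0.
apply: le_trans (lee_wpmul2l half_ge0 d_le) _.
by rewrite -EFinM lee_fin -mulr2n -[X in _ * X]mulr_natl mulKf.
Qed.
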